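(* Let $\mathcal X\subset\mathbb R^n$ be a nonempty closed convex set, $\|\cdot\|$ a norm on $\mathbb R^n$ with conjugate norm $\|\cdot\|_*$, and $h$ an $\mathcal X$-regularizer that is strongly convex (with modulus 1) with respect to $\|\cdot\|$. Let $M>0$ and let $f:\mathbb R^n\to\mathbb R\cup\{+\infty\}$ be a convex function with $\operatorname{dom}f\supset\mathcal X$, sub-differentiable on $\mathcal X$ (i.e. $\partial f(x)\neq\emptyset$ for $x\in\mathcal X$), such that $\|\zeta\|_*\le M$ for all $x\in\mathcal X$ and $\zeta\in\partial f(x)$. Assume that $f$ attains its minimum $f_*$ over $\mathcal X$ at some $x_*\in\mathcal X$, and that $x_*\in\operatorname{dom}h$. Let $(\gamma_t)_{t\ge1}$ be positive step-sizes and let $(x_t,\vartheta_t)_{t\ge1}$ be a sequence of UMD$(h,\xi)$ iterates with $\xi=(-\gamma_tf'(x_t))_{t\ge1}$, where $f'(x_t)\in\partial f(x_t)$. For $T\ge1$, let $\overline x_T$ be either $\big(\sum_{t=1}^T\gamma_t\big)^{-1}\sum_{t=1}^T\gamma_tx_t$, or a point among $x_1,\dots,x_T$ at which $f$ is minimal. Then for all $T\ge1$, $$f(\overline x_T)-f_*\le\Big(\sum_{t=1}^T\gamma_t\Big)^{-1}\Big[D_h(x_*,x_1;\vartheta_1)+\frac{M^2}{2}\sum_{t=1}^T\gamma_t^2\Big].$$ Moreover, let $\Omega_{\mathcal X}>0$ be an upper bound on $\sqrt{2D_h(x_*,x_1;\vartheta_1)}$. Then, for $T\ge 1$, with constant step-sizes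 $\gamma_t\equiv\gamma=\frac{\Omega_{\mathcal X}}{M\sqrt T}$, $t\ge1$, one has $$f(\overline x_T)-f_*\le\frac{\Omega_{\mathcal X}M}{\sqrt T}.$$
   Context: $\langle\cdot,\cdot\rangle$ is the canonical scalar product on $\mathbb R^n$; $\|\vartheta\|_*=\max_{\|x\|\le1}\langle\vartheta,x\rangle$. For convex $g:\mathbb R^n\to\mathbb R\cup\{+\infty\}$: $\operatorname{dom}g=\{x:g(x)<\infty\}$; $\partial g(x)$ is the set of $\vartheta\in\mathbb R^n$ with $g(x')-g(x)\ge\langle\vartheta,x'-x\rangle$ for all $x'\in\mathbb R^n$; $g^*(\vartheta)=\sup_{x}\{\langle\vartheta,x\rangle-g(x)\}$; for $\vartheta\in\partial g(x)$, the Bregman divergence with subgradient $\vartheta$ is $D_g(x',x;\vartheta)=g(x')-g(x)-\langle\vartheta,x'-x\rangle$. $g$ is strongly convex (modulus 1) w.r.t. $\|\cdot\|$ if $g(\lambda x+(1-\lambda)x')\le\lambda g(x)+(1-\lambda)g(x')-\frac{\lambda(1-\lambda)}2\|x'-x\|^2$ for all $x,x'\in\mathbb R^n$, $\lambda\in[0,1]$. An $\mathcal X$-regularizer is a function $h:\mathbb R^n\to\mathbb R\cup\{+\infty\}$ that is strictly convex, lower-semicontinuous, with $\operatorname{cl}\operatorname{dom}h=\mathcal X$ and $\operatorname{dom}h^*=\mathbb R^n$; then $h^*$ is differentiable on $\mathbb R^n$. UMD$(h,\xi)$ iterates: a sequence $(x_t,\vartheta_t)_{t\ge1}$ in $\mathbb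 R^n\times\mathbb R^n$ such that for all $t\ge1$: $x_t=\nabla h^*(\vartheta_t)$, and $\langle\vartheta_{t+1}-\vartheta_t-\xi_t,\,x-x_{t+1}\rangle\ge0$ for all $x\in\mathcal X$. One has $\vartheta_t\in\partial h(x_t)$ (equivalent to $x_t=\nabla h^*(\vartheta_t)$), so $D_h(\cdot,x_t;\vartheta_t)$ is well defined, and $x_t\in\operatorname{dom} h\subset\mathcal X$. *)

(* Defs.v *)
From HB Require Import structures.
From mathcomp Require Import all_boot all_order all_algebra.
From mathcomp Require Import all_classical all_reals all_analysis.

Set Implicit Arguments.
Unset Strict Implicit.
Unset Printing Implicit Defensive.
Import Order.TTheory GRing.Theory Num.Theory.
Import numFieldNormedType.Exports.

Local Open Scope classical_set_scope.
Local Open Scope ring_scope.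

Section Defs.
Context {R : realType} {n : nat}.
Local Notation E := 'rV[R]_n.
Implicit Types (x y v theta : E) (g f h : E -> \bar R) (X : set E).

Definition dotp v x : R := \sum_(i < n) v 0 i * x 0 i.

(* The norm that 'rV[R]_n carries in the library is the max norm; an arbitrary
   norm is therefore a function N. The topology on 'rV[R]_n is the usual one,
   so closures, lower semicontinuity and differentials do not depend on N. *)
Record is_norm (N : E -> R) : Prop := IsNorm {
  is_norm_eq0 : forall x, N x = 0 -> x = 0 ;
  is_normZ : forall (a : R) x, N (a *: x) = `|a| * N x ;
  is_normD : forall x y, N (x + y) <= N x + N y }.

Definition dual_norm (N : E -> R) theta : R :=
  sup [set dotp theta x | x in [set x | N x <= 1]].

(* Functions with values in R U {+oo} are functions into \bar R that never
   take the value -oo. For those, with 0 * +oo = 0, the right-hand sides of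
   the convexity inequalities below never involve +oo - oo, and the
   inequalities are trivial at the endpoints 0 and 1. *)
Definition proper_valued g := forall x, g x != -oo%E.

Definition edom g : set E := [set x | (g x < +oo)%E].

Definition econvex g := forall x y (lambda : R), 0 <= lambda <= 1 ->
  (g (lambda *: x + (1 - lambda) *: y)%R
   <= lambda%:E * g x + (1 - lambda)%R%:E * g y)%E.

Definition strictly_econvex g := forall x y (lambda : R),
  edom g x -> edom g y -> x <> y -> 0 < lambda < 1 ->
  (g (lambda *: x + (1 - lambda) *: y)%R
   < lambda%:E * g x + (1 - lambda)%R%:E * g y)%E.

Definition strongly_econvex (N : E -> R) g :=
  forall x y (lambda : R), 0 <= lambda <= 1 ->
  (g (lambda *: x + (1 - lambda) *: y)%R
   <= lambda%:E * g x + (1 - lambda)%R%:E * g y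
      - (lambda * (1 - lambda) / 2 * N (y - x) ^+ 2)%R%:E)%E.

(* As a - +oo = -oo in \bar R, including a = +oo, the subdifferential is empty
   outside of edom g. *)
Definition subdifferential g x : set E :=
  [set theta | forall y, ((dotp theta (y - x)%R)%:E <= g y - g x)%E].

Definition conjugate g theta : \bar R :=
  ereal_sup (range (fun x => ((dotp theta x)%:E - g x)%E)).

Definition bregman g y x theta : \bar R :=
  (g y - g x - (dotp theta (y - x)%R)%:E)%E.

Record is_regularizer X h : Prop := IsRegularizer {
  regularizer_proper : proper_valued h ;
  regularizer_convex : strictly_econvex h ;
  regularizer_lsc : lower_semicontinuous h ;
  regularizer_dom : closure (edom h) = X ;
  regularizer_conj : edom (conjugate h) = setT }.

Definition is_gradient (g : E -> R) theta v : Prop :=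
  is_diff theta (g : E -> R^o) (dotp v : E -> R^o).

(* The conjugate of a regularizer of a nonempty set is finite everywhere, so
   that taking its real part with fine loses nothing. The sequences are
   indexed from 1: their values at 0 are irrelevant. *)
Definition umd_iterates X h (xi x theta : nat -> E) : Prop :=
  forall t, (1 <= t)%N ->
    is_gradient (fine \o conjugate h) (theta t) (x t) /\
    (forall y, X y -> 0 <= dotp (theta t.+1 - theta t - xi t) (y - x t.+1)).

Definition weighted_average (gamma : nat -> R) (x : nat -> E) (T : nat) : E :=
  (\sum_(1 <= t < T.+1) gamma t)^-1 *: \sum_(1 <= t < T.+1) gamma t *: x t.

Definition best_iterate f (x : nat -> E) (T : nat) : set E :=
  [set y | exists2 t, (1 <= t <= T)%N &
     y = x t /\ forall s, (1 <= s <= T)%N -> (f (x t) <= f (x s))%E].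

End Defs.

(* Main.v *)
Require Import Defs.
From mathcomp Require Import all_boot all_order all_algebra.
From mathcomp Require Import all_classical all_reals all_analysis.
From mathcomp Require Import ring lra.
Import Order.TTheory GRing.Theory Num.Theory.
Import numFieldNormedType.Exports.
Local Open Scope classical_set_scope.
Local Open Scope ring_scope.

(* Differentiability of h^* at theta_t forces approximate maximizers of
   <theta_t, .> - h to converge to x_t = grad h^*(theta_t), so lower
   semicontinuity makes theta_t a subgradient of h at x_t, without
   Fenchel-Moreau duality. Strong convexity then gives
   D_h(y, x_t) >= N(y - x_t)^2 / 2, and with the update inequality and the
   three-point identity one gets, for z the minimizer of f,
     gamma_t (f(x_t) - f(z))
       <= D_h(z, x_t) - D_h(z, x_{t+1}) + M^2 gamma_t^2 / 2,
   which telescopes; convexity of f passes to the averaged iterate. *)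

(** * The scalar product against the max norm [|v|] *)

Section ScalarProduct.
Context {R : realType} {n : nat}.
Implicit Types (u v w : 'rV[R]_n) (a : R).

Lemma dotpC u v : dotp u v = dotp v u.
Proof. by apply: eq_bigr => i _; rewrite mulrC. Qed.

Lemma dotpDr u v w : dotp u (v + w) = dotp u v + dotp u w.
Proof. by rewrite -big_split; apply: eq_bigr => i _; rewrite mxE mulrDr. Qed.

Lemma dotpZr a u v : dotp u (a *: v) = a * dotp u v.
Proof. by rewrite mulr_sumr; apply: eq_bigr => i _; rewrite mxE mulrCA. Qed.

Lemma dotpNr u v : dotp u (- v) = - dotp u v.
Proof. by rewrite -scaleN1r dotpZr mulN1r. Qed.

Lemma dotpDl u v w : dotp (u + v) w = dotp u w + dotp v w.
Proof. by rewrite !(dotpC _ w) dotpDr. Qed.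

Lemma dotpZl a u v : dotp (a *: u) v = a * dotp u v.
Proof. by rewrite !(dotpC _ v) dotpZr. Qed.

Lemma dotpNl u v : dotp (- u) v = - dotp u v.
Proof. by rewrite !(dotpC _ v) dotpNr. Qed.

Definition dotpE := (dotpDl, dotpDr, dotpZl, dotpZr, dotpNl, dotpNr).

Lemma ler_coord_norm v i : `|v 0 i| <= `|v|.
Proof.
by rewrite [leRHS]/Num.Def.normr /= mx_normrE; apply/bigmax_geP; right;
   exists (0, i).
Qed.

Lemma ler_dotp_norm u v : dotp u v <= (\sum_i `|u 0 i|) * `|v|.
Proof.
rewrite mulr_suml; apply: ler_sum => i _.
by rewrite (le_trans (ler_norm _))// normrM ler_wpM2l ?ler_coord_norm.
Qed.

(** The max norm is attained at some coordinate, whose square is one of the nonnegative terms of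
    [dotp v v]. *)
Lemma sqr_norm_le_dotp v : `|v| ^+ 2 <= dotp v v.
Proof.
have [->|v0] := eqVneq v 0.
  by rewrite normr0 expr0n sumr_ge0// => i _; rewrite -expr2 sqr_ge0.
have /mx_norm_neq0[[i j] /= vij] : mx_norm v != 0.
  by rewrite -[mx_norm v]/`|v| normr_eq0.
rewrite -[`|v|]/(mx_norm v) vij (ord1 i) real_normK ?num_real//.
rewrite /dotp (bigD1 j)//= -expr2.
by rewrite lerDl sumr_ge0// => k _; rewrite -expr2 sqr_ge0.
Qed.

End ScalarProduct.

(** * Equivalence of [N] with the max norm, and duality *)

Section Norms.
Context {R : realType} {n : nat} {N : 'rV[R]_n -> R}.
Hypothesis normN : is_norm N.
Implicit Types (x y : 'rV[R]_n).

Lemma is_norm0 : N 0 = 0.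
Proof. by rewrite -(scale0r 0) (is_normZ normN) normr0 mul0r. Qed.

Lemma is_normNE x : N (- x) = N x.
Proof. by rewrite -scaleN1r (is_normZ normN) normrN1 mul1r. Qed.

Lemma is_norm_ge0 x : 0 <= N x.
Proof.
have := is_normD normN x (- x); rewrite subrr is_norm0 is_normNE -mulr2n.
by rewrite pmulrn_lge0.
Qed.

Lemma is_norm_le_norm x : N x <= (\sum_i N 'e_i) * `|x|.
Proof.
rewrite {1}(row_sum_delta x) mulr_suml.
elim/big_ind2: _ => [|a b c d ab cd|i _]; first by rewrite is_norm0.
- by rewrite (le_trans (is_normD normN _ _))// lerD.
- by rewrite (is_normZ normN) mulrC ler_wpM2l ?is_norm_ge0 ?ler_coord_norm.
Qed.

(** By the triangle inequality and the expansion in the canonical basis, [N] is Lipschitz for the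
    max norm. *)
Lemma is_norm_continuous : continuous N.
Proof.
move=> x; apply/(@cvgrPdist_le R R^o _ _ (nbhs_filter x)) => e e0.
set K := \sum_i N 'e_i.
have K0 : 0 <= K by rewrite sumr_ge0// => i _; rewrite is_norm_ge0.
have lip u v : N u - N v <= K * `|u - v|.
  rewrite lerBlDr (le_trans _ (lerD (is_norm_le_norm _) (lexx _)))//.
  by rewrite -{1}(subrK v u) (is_normD normN).
(* [K] vanishes when [n = 0], so the radius is obtained by dividing by [K + 1]. *)
have K1 : 0 < K + 1 by rewrite ltr_wpDl.
apply/nbhs_ballP; exists (e / (K + 1)); first by rewrite /= divr_gt0.
move=> y; rewrite -ball_normE /= ltr_pdivlMr// => /ltW xye.
have : K * `|x - y| <= e.
  by rewrite (le_trans _ xye)// mulrC ler_wpM2l// lerDl.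
apply: le_trans; rewrite ler_norml lip andbT.
by rewrite lerNl opprB distrC lip.
Qed.

(** The continuous [N] attains a positive minimum on the compact unit sphere of the max norm; its
    inverse is the constant. *)
Lemma norm_le_is_norm : exists2 c, 0 < c & forall x, `|x| <= c * N x.
Proof.
pose S := [set x : 'rV[R]_n | `|x| = 1].
(* The sphere is empty when [n = 0], and then every vector is [0]. *)
have [S0|/set0P S0] := eqVneq S set0.
  exists 1 => // x; have [->|x0] := eqVneq x 0.
    by rewrite normr0 mul1r is_norm_ge0.
  suff : S (`|x|^-1 *: x) by rewrite S0.
  by rewrite /S /= normrZ normfV normr_id mulVf ?normr_eq0.
have compS : compact S.
  apply: bounded_closed_compact.
    by exists 1; split => // M M1 x /= ->; exact: ltW.
  have -> : S = (fun x => `|x|) @^-1` [set 1] by [].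
  apply: preimage_closed; last exact: closed_eq.
  by move=> x _; exact: norm_continuous.
have [c /set_mem cS cmin] := EVT_min_rV S0 compS
  (continuous_subspaceT is_norm_continuous).
have Nc : 0 < N c.
  rewrite lt_def is_norm_ge0 andbT; apply/eqP => /(is_norm_eq0 normN) c0.
  by move: cS; rewrite /S /= c0 normr0 => /eqP; rewrite eq_sym oner_eq0.
exists (N c)^-1; first by rewrite invr_gt0.
move=> x; have [->|x0] := eqVneq x 0.
  by rewrite normr0 mulr_ge0 ?invr_ge0 ?is_norm_ge0.
have nx : 0 < `|x| by rewrite normr_gt0.
rewrite ler_pdivlMl// -ler_pdivlMr// mulrC.
have /cmin : `|x|^-1 *: x \in S.
  by apply/mem_set; rewrite /S /= normrZ normfV normr_id mulVf ?gt_eqF.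
by rewrite (is_normZ normN) normfV normr_id.
Qed.

Lemma dotp_le_dual_norm u x : dotp u x <= dual_norm N u * N x.
Proof.
have [c c0 cN] := norm_le_is_norm.
(* [dual_norm] is a supremum in the reals, meaningful only for a bounded set; the bound comes from
   the equivalence of norms. *)
have bd : has_ubound [set dotp u x | x in [set x | N x <= 1]].
  exists ((\sum_i `|u 0 i|) * c) => _ [y /= Ny1 <-].
  rewrite (le_trans (ler_dotp_norm _ _))// ler_wpM2l ?sumr_ge0//.
  by rewrite (le_trans (cN _))// -[leRHS]mulr1 ler_wpM2l// ltW.
have [->|x0] := eqVneq x 0.
  by rewrite is_norm0 mulr0 -(scale0r 0) dotpZr mul0r.
have Nx : 0 < N x.
  rewrite lt_def is_norm_ge0 andbT.
  by apply: contra x0 => /eqP/(is_norm_eq0 normN)->.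
rewrite -ler_pdivrMr// mulrC -dotpZr; apply: ub_le_sup => //.
exists ((N x)^-1 *: x) => //=.
by rewrite (is_normZ normN) ger0_norm ?invr_ge0 ?is_norm_ge0// mulVf// gt_eqF.
Qed.

End Norms.

(** * Conjugates, gradients and subgradients of extended-valued functions *)

Section ConvexFunctions.
Set Implicit Arguments.
Unset Strict Implicit.
Context {R : realType} {n : nat}.
Implicit Types (g : 'rV[R]_n -> \bar R) (u v x y theta : 'rV[R]_n).

Lemma edom_fin_num g x : proper_valued g -> edom g x -> g x \is a fin_num.
Proof. by move=> gp gx; rewrite fin_numE gp/= lt_eqF. Qed.

(** If [g x] were [+oo], the subgradient inequality tested at a point of the domain would have
    right-hand side [-oo]. *)
Lemma subdifferential_edom g x theta :
  edom g !=set0 -> subdifferential g x theta -> edom g x.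
Proof.
move=> [y gy] /(_ y); rewrite /edom /= in gy *.
by rewrite ltey; case: (g x) => //; move: gy; case: (g y).
Qed.

Lemma conjugate_fin_num g theta :
  proper_valued g -> edom g !=set0 -> edom (conjugate g) theta ->
  conjugate g theta \is a fin_num.
Proof.
move=> gp [y gy] cg; rewrite fin_numElt; apply/andP; split => //.
have : ((dotp theta y)%:E - g y <= conjugate g theta)%E.
  by apply: ereal_sup_ubound; exists y.
by apply: lt_le_trans; rewrite -(fineK (edom_fin_num gp gy)) -EFinB ltNyr.
Qed.

Lemma gradient_linear_approx (F : 'rV[R]_n -> R) theta v (e : R) :
  is_gradient F theta v -> 0 < e ->
  exists2 d, 0 < d & forall u, `|u| < d ->
    F (theta + u) <= F theta + dotp v u + e * `|u|.
Proof.
move=> [dF Fv] e0.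
have /eqaddoP/(_ _ e0) /nbhs_ballP[d /= d0 dP] := diff_locally dF.
exists d => // u ud; have /dP : ball (0 : 'rV[R]_n) d u.
  by rewrite -ball_normE /= sub0r normrN.
rewrite Fv /= !fctE /= => /(le_trans (ler_norm _)).
by rewrite lerBlDl [u + _]addrC.
Qed.

(* If y is a q-maximizer of <theta, .> - g, then g^* (theta + u) is at least
   g^* theta + <u, y> - q for all u, so that differentiability of g^* at theta
   pins y near the gradient: take u of small length directed along y - x. *)
Lemma near_gradient_conjugate g theta x (r q : R) :
  proper_valued g -> edom g !=set0 -> edom (conjugate g) = setT ->
  is_gradient (fine \o conjugate g) theta x -> 0 < r -> 0 < q ->
  exists2 y, `|y - x| < r & exists2 a, g y = a%:E &
    fine (conjugate g theta) <= dotp theta y - a + q.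
Proof.
move=> gp g0 gdom grad r0 q0.
have cfin u : conjugate g u = (fine (conjugate g u))%:E.
  by rewrite fineK// conjugate_fin_num// gdom.
have [d d0 dP] := gradient_linear_approx grad (divr_gt0 r0 (ltr0n R 4)).
set F := fine \o conjugate g in dP *.
pose s := d / 2; have s0 : 0 < s by rewrite divr_gt0.
(* The maximization gap and the error of the linear approximation at distance [s] each cost at most
   [r / 4 * s], which leaves [|y - x| <= r / 2]. *)
pose p := Num.min q (r / 4 * s).
have p0 : 0 < p by rewrite lt_min q0/= mulr_gt0// divr_gt0.
have [|_ [y _ <-] yp] := @ub_ereal_sup_adherent _
    (range (fun x => ((dotp theta x)%:E - g x)%E)) _ p0.
  by rewrite -/(conjugate g theta) cfin.
rewrite -/(conjugate g theta) cfin in yp.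
have : g y \is a fin_num.
  rewrite fin_numE gp/=; apply/eqP => gy; move: yp.
  by rewrite gy.
case gy : (g y) yp => [a| |] // yp _.
have {}yp : F theta - p <= dotp theta y - a.
  by move: yp => /ltW; rewrite -!EFinB lee_fin.
exists y; last first.
  exists a => //; rewrite -lerBlDr (le_trans _ yp)// lerB//.
  by rewrite ge_min lexx.
have [->|yx] := eqVneq y x; first by rewrite subrr normr0.
have z0 : 0 < `|y - x| by rewrite normr_gt0 subr_eq0.
set z := y - x in z0 *.
pose u := (s / `|z|) *: z.
have us : `|u| = s.
  by rewrite normrZ ger0_norm ?divr_ge0 ?ltW// divfK// gt_eqF.
have zu : s * `|z| <= dotp u z.
  rewrite dotpZl -[leRHS]mulrA ler_wpM2l ?(ltW s0)// ler_pdivlMl// -expr2.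
  exact: sqr_norm_le_dotp.
clearbody u.
have /dP : `|u| < d by rewrite us /s ltr_pdivrMr// mulr_natr mulr2n ltrDl.
have : dotp (theta + u) y - a <= F (theta + u).
  rewrite -lee_fin /F /= -cfin EFinB -gy; apply: ereal_sup_ubound.
  by exists y.
have : p <= r / 4 * s by rewrite ge_min lexx orbT.
rewrite us [dotp x u]dotpC dotpDl => pr Fu dFu.
rewrite {2}/z dotpDr dotpNr in zu.
have : s * `|z| <= s * (r / 2) by lra.
by rewrite ler_pM2l// => /le_lt_trans; apply; lra.
Qed.

Lemma gradient_conjugate_subdifferential g theta x :
  proper_valued g -> edom g !=set0 -> edom (conjugate g) = setT ->
  lower_semicontinuous g -> is_gradient (fine \o conjugate g) theta x ->
  subdifferential g x theta.
Proof.
move=> gp g0 gdom glsc grad.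
have cfin : conjugate g theta = (fine (conjugate g theta))%:E.
  by rewrite fineK// conjugate_fin_num// gdom.
set H := fine (conjugate g theta) in cfin.
(* Otherwise lower semicontinuity keeps [g] above [dotp theta x - H + e], for some [e > 0], on a
   neighbourhood of [x], and a near-maximizer in it gives a contradiction. *)
have gx : (g x <= (dotp theta x - H)%:E)%E.
  apply/lee_addgt0Pr => e e0; rewrite leNgt; apply/negP.
  rewrite -EFinD => /glsc.
  move=> [V /nbhs_ballP[d /= d0 dV] Ve].
  pose C := \sum_i `|theta 0 i|.
  have C1 : 0 < C + 1 by rewrite ltr_wpDl// sumr_ge0.
  (* Half of [e] pays for the maximization gap, the other half for the variation of [dotp theta]
     between [x] and [y], at most [C * |y - x|]. *)
  have [||y + [a gy Ha]] := @near_gradient_conjugate g theta x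
    (Num.min d (e / 2 / (C + 1))) (e / 2) gp g0 gdom grad.
  - by rewrite lt_min d0 !divr_gt0.
  - by rewrite divr_gt0.
  rewrite lt_min => /andP[yd]; rewrite ltr_pdivlMr// => ye.
  have /dV/Ve : ball x d y by rewrite -ball_normE /= distrC.
  rewrite gy lte_fin ltNge => /negP; apply.
  have := ler_dotp_norm theta (y - x).
  rewrite -/C !dotpE.
  have := normr_ge0 (y - x).
  rewrite -/H in Ha; nra.
have gxfin : g x \is a fin_num.
  by rewrite fin_numE gp lt_eqF// (le_lt_trans gx)// ltry.
rewrite -(fineK gxfin) lee_fin in gx.
(* Fenchel's inequality at [y], added to [gx], is the subgradient inequality. *)
move=> y; case gy : (g y) => [b| |]; last by have := gp y; rewrite gy.
- have : ((dotp theta y)%:E - g y <= conjugate g theta)%E.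
    by apply: ereal_sup_ubound; exists y.
  rewrite cfin gy -EFinB lee_fin => Hb.
  by rewrite -(fineK gxfin) -EFinB lee_fin !dotpE; lra.
- by rewrite -(fineK gxfin) addye// leey.
Qed.

(** Bound [g] at [x + l (y - x)] below by the subgradient and above by strong convexity, divide by
    [l], and let [l] tend to [0]. *)
Lemma strongly_econvex_bregman (N : 'rV[R]_n -> R) g x y theta a b :
  strongly_econvex N g -> subdifferential g x theta ->
  g x = a%:E -> g y = b%:E -> N (y - x) ^+ 2 / 2 <= b - a - dotp theta (y - x).
Proof.
move=> gN gx ga gb.
have step l : 0 < l < 1 ->
    (1 - l) * (N (y - x) ^+ 2 / 2) <= b - a - dotp theta (y - x).
  move=> /andP[l0 l1].
  have := gx ((1 - l) *: x + (1 - (1 - l)) *: y).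
  have := gN x y (1 - l); rewrite subr_ge0 (ltW l1) gerBl (ltW l0) => /(_ isT).
  rewrite ga gb; case: (g _) => [c| |]//; rewrite lee_fin => cle.
  rewrite lee_fin => /le_trans/(_ (lerB cle (lexx _))).
  have -> : (1 - l) *: x + (1 - (1 - l)) *: y - x = l *: (y - x).
    by apply/rowP => i; rewrite !mxE; ring.
  rewrite dotpZr => cge; rewrite -(ler_pM2l l0); lra.
apply/ler_addgt0Pr => e e0; set A := N (y - x) ^+ 2 / 2 in step *.
have A0 : 0 <= A by rewrite divr_ge0// sqr_ge0.
(* Small enough that [l < 1] and [l * A <= e]. *)
pose l := e / (A + e + 1).
have Ae : 0 < A + e + 1 by rewrite ltr_wpDl// addr_ge0// ltW.
have l01 : 0 < l < 1 by rewrite divr_gt0//= /l ltr_pdivrMr//; lra.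
have lA : l * A <= e.
  rewrite /l mulrAC ler_pdivrMr// ler_pM2l//; lra.
have := step _ l01; lra.
Qed.

(** * Jensen's inequality for weighted averages *)

Lemma weighted_averageS (gamma : nat -> R) (x : nat -> 'rV[R]_n) T :
  let S := \sum_(1 <= t < T.+1) gamma t in
  let S' := \sum_(1 <= t < T.+2) gamma t in
  S != 0 -> S' != 0 ->
  weighted_average gamma x T.+1 =
    (S / S') *: weighted_average gamma x T + (1 - S / S') *: x T.+1.
Proof.
move=> S S' S0 S'0; rewrite /weighted_average -/S -/S' scalerA.
have -> : 1 - S / S' = gamma T.+1 / S'.
  by rewrite -{1}(divff S'0) -mulrBl /S' big_nat_recr//= -/S addrAC subrr add0r.
rewrite mulrAC divff// mul1r [in LHS]big_nat_recr//= scalerDr scalerA.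
by rewrite [gamma _ / _]mulrC.
Qed.

(** Induction on [T]: each new average is a convex combination of the previous one and the new
    point, so the two-point inequality suffices. *)
Lemma econvex_weighted_average g (gamma a : nat -> R) (x : nat -> 'rV[R]_n) T :
  econvex g -> (forall t, (1 <= t)%N -> 0 < gamma t) ->
  (forall t, (1 <= t)%N -> g (x t) = (a t)%:E) -> (1 <= T)%N ->
  (g (weighted_average gamma x T) <=
   ((\sum_(1 <= t < T.+1) gamma t)^-1 *
    \sum_(1 <= t < T.+1) gamma t * a t)%:E)%E.
Proof.
move=> gc gam0 ga; elim: T => // -[_ _|T IH _].
  rewrite /weighted_average !big_nat1 scalerA mulrA mulVf ?gt_eqF ?gam0//.
  by rewrite scale1r mul1r ga.
have Spos k : 0 < \sum_(1 <= t < k.+2) gamma t.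
  elim: k => [|k IHk]; first by rewrite big_nat1 gam0.
  by rewrite big_nat_recr//= addr_gt0 ?gam0.
rewrite weighted_averageS ?gt_eqF//.
have := IH isT; have := Spos T.
rewrite [\sum_(1 <= t < T.+3) gamma t]big_nat_recr//=.
rewrite [\sum_(1 <= t < T.+3) _ * _]big_nat_recr//=.
set S := \sum_(1 <= t < T.+2) gamma t; set P := \sum_(1 <= t < T.+2) _ * _.
set G := gamma _ => S0 {}IH.
have G0 : 0 < G by exact: gam0.
have lam : 0 <= S / (S + G) <= 1.
  rewrite ler_pdivrMr ?addr_gt0// mul1r lerDl (ltW G0) andbT.
  by rewrite divr_ge0 ?addr_ge0 ?(ltW S0) ?(ltW G0).
apply: (le_trans (gc _ _ _ lam)); rewrite ga//.
have -> : ((S + G)^-1 * (P + G * a T.+2))%:E =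
    ((S / (S + G))%:E * (S^-1 * P)%:E + (1 - S / (S + G))%:E * (a T.+2)%:E)%E.
  by rewrite -!EFinM -EFinD; congr (_%:E); field; rewrite !gt_eqF ?addr_gt0.
by rewrite leeD2r// lee_wpmul2l// lee_fin; case/andP: lam.
Qed.

End ConvexFunctions.

(** * One step of mirror descent *)

Section MirrorDescent.
Set Implicit Arguments.
Unset Strict Implicit.
Context {R : realType} {n : nat}.
Implicit Types (g h f : 'rV[R]_n -> \bar R) (u v x y z theta zeta : 'rV[R]_n).

(* The optimality condition for y and the three-point identity give
     D_h(z, y) - D_h(z, x)
       <= gamma <zeta, z - x> + gamma <zeta, x - y> - D_h(y, x),
   and gamma <zeta, x - y> <= (gamma M)^2 / 2 + N(x - y)^2 / 2. *)
Lemma mirror_descent_step (N : 'rV[R]_n -> R) h f x y z theta eta zeta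
    (M gamma a b c p q : R) :
  is_norm N -> strongly_econvex N h -> 0 <= gamma ->
  h x = a%:E -> h y = b%:E -> h z = c%:E -> f x = p%:E -> f z = q%:E ->
  subdifferential h x theta -> subdifferential f x zeta ->
  dual_norm N zeta <= M ->
  0 <= dotp (eta - theta - - (gamma *: zeta)) (z - y) ->
  gamma * (p - q) <= (c - a - dotp theta (z - x)) - (c - b - dotp eta (z - y))
                     + M ^+ 2 / 2 * gamma ^+ 2.
Proof.
move=> normN hN gamma0 ha hb hc fp fq hx fx zetaM opt.
have hyx := strongly_econvex_bregman hN hx ha hb.
have fz : dotp zeta (z - x) <= q - p.
  by move: (fx z); rewrite fp fq -EFinB lee_fin.
have zN : dotp zeta (x - y) <= M * N (y - x).
  apply: (le_trans (dotp_le_dual_norm normN _ _)).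
  by rewrite -opprB (is_normNE normN) ler_wpM2r ?(is_norm_ge0 normN).
have am : gamma * (M * N (y - x)) <=
    M ^+ 2 / 2 * gamma ^+ 2 + N (y - x) ^+ 2 / 2.
  by have := sqr_ge0 (gamma * M - N (y - x)); lra.
have {}zN := ler_wpM2l gamma0 zN.
have {}fz := ler_wpM2l gamma0 fz.
move: opt hyx zN fz am; rewrite !dotpE; lra.
Qed.

End MirrorDescent.

(** * Summation of the steps and the resulting rates *)

Theorem proposition4p1 (R : realType) (n : nat)
    (X : set 'rV[R]_n) (N : 'rV[R]_n -> R) (h f : 'rV[R]_n -> \bar R) (M : R)
    (xstar : 'rV[R]_n) (gamma : nat -> R) (x theta f' : nat -> 'rV[R]_n) :
  X !=set0 -> closed X -> convex_set X ->
  is_norm N ->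
  is_regularizer X h -> strongly_econvex N h ->
  0 < M ->
  proper_valued f -> econvex f -> X `<=` edom f ->
  (forall y, X y -> subdifferential f y !=set0) ->
  (forall y zeta, X y -> subdifferential f y zeta -> dual_norm N zeta <= M) ->
  X xstar -> (forall y, X y -> (f xstar <= f y)%E) -> edom h xstar ->
  (forall t, (1 <= t)%N -> 0 < gamma t) ->
  (forall t, (1 <= t)%N -> subdifferential f (x t) (f' t)) ->
  umd_iterates X h (fun t => - (gamma t *: f' t)) x theta ->
  (forall (T : nat) (xbar : 'rV[R]_n), (1 <= T)%N ->
     xbar = weighted_average gamma x T \/ best_iterate f x T xbar ->
     (f xbar - f xstar
      <= ((\sum_(1 <= t < T.+1) gamma t)^-1)%R%:E
         * (bregman h xstar (x 1%N) (theta 1%N)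
            + (M ^+ 2 / 2 * \sum_(1 <= t < T.+1) gamma t ^+ 2)%R%:E))%E)
  /\
  (forall (Omega : R) (T : nat) (xbar : 'rV[R]_n), 0 < Omega ->
     (sqrte (2%:E * bregman h xstar (x 1%N) (theta 1%N)) <= Omega%:E)%E ->
     (1 <= T)%N ->
     (forall t, (1 <= t)%N -> gamma t = Omega / (M * Num.sqrt T%:R)) ->
     xbar = weighted_average gamma x T \/ best_iterate f x T xbar ->
     (f xbar - f xstar <= (Omega * M / Num.sqrt T%:R)%R%:E)%E).
Proof.
move=> _ _ _ normN [hp _ hlsc hdom hconj] hN M0 fp fconv Xf _ fM Xs _ hs
  gamma0 ff' umd.
have h0 : edom h !=set0 by exists xstar.
have hsub t : (1 <= t)%N -> subdifferential h (x t) (theta t).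
  move=> /umd[grad _].
  exact: gradient_conjugate_subdifferential hp h0 hconj hlsc grad.
have hfin t : (1 <= t)%N -> h (x t) = (fine (h (x t)))%:E.
  move=> /hsub ht.
  by rewrite fineK// edom_fin_num//; exact: subdifferential_edom ht.
have Xx t : (1 <= t)%N -> X (x t).
  move=> t1; rewrite -hdom; apply: subset_closure.
  by rewrite /edom /= hfin// ltry.
have ffin y : X y -> f y = (fine (f y))%:E.
  by move=> /Xf fy; rewrite fineK// edom_fin_num.
have hsfin : h xstar = (fine (h xstar))%:E by rewrite fineK// edom_fin_num.
(* All values involved are finite, so the argument moves to the reals; [D t] is the divergence of
   [xstar] from [x t]. *)
pose F t := fine (f (x t)); pose q := fine (f xstar).
pose D t := fine (h xstar) - fine (h (x t)) - dotp (theta t) (xstar - x t).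
have D0 t : (1 <= t)%N -> 0 <= D t.
  move=> t1; have := hsub t t1 xstar.
  by rewrite hsfin hfin// -EFinB lee_fin subr_ge0.
have step t : (1 <= t)%N ->
    gamma t * (F t - q) <= D t - D t.+1 + M ^+ 2 / 2 * gamma t ^+ 2.
  move=> t1; have [_ opt] := umd t t1.
  by apply: (mirror_descent_step normN hN (ltW (gamma0 t t1)) (hfin t t1)
    (hfin t.+1 isT) hsfin (ffin _ (Xx t t1)) (ffin _ Xs) (hsub t t1) (ff' t t1)
    (fM _ _ (Xx t t1) (ff' t t1)) (opt _ Xs)).
have regret T : \sum_(1 <= t < T.+1) gamma t * (F t - q) <=
    D 1%N + M ^+ 2 / 2 * \sum_(1 <= t < T.+1) gamma t ^+ 2.
  rewrite mulr_sumr -lerBlDr -sumrB.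
  (* The differences of [D] telescope, and the last divergence is dropped because it is
     nonnegative. *)
  rewrite (@le_trans _ _ (D 1%N - D T.+1))//; last by rewrite gerBl D0.
  rewrite -opprB -(telescope_sumr D (ltn0Sn T)) -sumrN.
  by apply: ler_sum_nat => t /andP[t1 _]; rewrite opprB lerBlDr step.
have breg : bregman h xstar (x 1%N) (theta 1%N) = (D 1%N)%:E.
  by rewrite /bregman hsfin hfin.
have gap T xbar : (1 <= T)%N ->
    xbar = weighted_average gamma x T \/ best_iterate f x T xbar ->
    (f xbar - f xstar <= ((\sum_(1 <= t < T.+1) gamma t)^-1 *
      (D 1%N + M ^+ 2 / 2 * \sum_(1 <= t < T.+1) gamma t ^+ 2))%:E)%E.
  move=> T1 xbarE.
  have S0 : 0 < \sum_(1 <= t < T.+1) gamma t.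
    case: T T1 {xbarE} => // T _; rewrite big_nat_recl//= ltr_wpDr ?gamma0//.
    by rewrite big_nat_cond sumr_ge0// => t _; rewrite ltW ?gamma0.
  (* Both choices of [xbar] lie below the weighted mean of the values: the average by Jensen, the
     best iterate because a minimum is below any mean. *)
  have : (f xbar <= ((\sum_(1 <= t < T.+1) gamma t)^-1 *
                     \sum_(1 <= t < T.+1) gamma t * F t)%:E)%E.
    case: xbarE => [->|[t /andP[t1 tT] [-> best]]].
      by apply: econvex_weighted_average => // t t1; exact/ffin/Xx.
    rewrite (ffin _ (Xx t t1)) lee_fin ler_pdivlMl// mulr_suml.
    apply: ler_sum_nat => s /andP[s1 sT].
    rewrite ler_wpM2l ?(ltW (gamma0 _ s1))//.
    by rewrite -lee_fin -!ffin; [apply: best; rewrite s1|exact: Xx..].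
  rewrite (ffin _ Xs) -/q leeBlDr// => /le_trans; apply.
  rewrite -EFinD lee_fin -lerBlDr -(ler_pM2l S0) mulVKf ?gt_eqF// mulrBr.
  rewrite mulVKf ?gt_eqF//; apply: le_trans (regret T).
  under [leRHS]eq_bigr do rewrite mulrBr.
  by rewrite sumrB mulr_suml.
split=> [T xbar T1 xbarE|Omega T xbar Omega0].
  by rewrite breg -EFinD -EFinM; exact: gap.
rewrite breg -EFinM /= lee_fin => DOmega T1 gammaE.
move=> /(gap _ _ T1)/le_trans; apply.
have {}DOmega : 2 * D 1%N <= Omega ^+ 2.
  rewrite -(sqr_sqrtr (_ : 0 <= 2 * D 1%N)) ?mulr_ge0 ?D0//.
  by rewrite ler_sqr ?nnegrE ?sqrtr_ge0 ?(ltW Omega0).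
rewrite lee_fin.
have sumE (c : R) (u : nat -> R) : (forall t, (1 <= t)%N -> u t = c) ->
    \sum_(1 <= t < T.+1) u t = c * T%:R.
  move=> uc; rewrite (eq_big_nat _ _ (F2 := fun=> c)); last first.
    by move=> t /andP[t1 _]; exact: uc.
  by rewrite big_const_nat iter_addr_0 subn1 mulr_natr.
have T0 : (0 : R) < T%:R by rewrite ltr0n.
rewrite (sumE _ _ gammaE) (sumE ((Omega / (M * Num.sqrt T%:R)) ^+ 2));
  last by move=> t /gammaE ->.
have r0 : 0 < Num.sqrt (T%:R : R) by rewrite sqrtr_gt0.
set r := Num.sqrt _ in r0 *.
have -> : T%:R = r ^+ 2 by rewrite sqr_sqrtr ?ler0n.
(* This step-size balances the bound: [D 1] and the quadratic term each contribute at most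
   [Omega ^+ 2 / 2], and the total weight is [Omega * r / M]. *)
have -> : Omega * M / r =
    (Omega / (M * r) * r ^+ 2)^-1 *
    (Omega ^+ 2 / 2 + M ^+ 2 / 2 * ((Omega / (M * r)) ^+ 2 * r ^+ 2)).
  by field; rewrite !gt_eqF.
rewrite ler_wpM2l ?lerD2r; first by [].
  rewrite invr_ge0 mulr_ge0 ?sqr_ge0// divr_ge0 ?mulr_ge0//; exact: ltW.
by lra.
Qed.
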